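(* Bour's minimal surface of value $4$, $\mathfrak{B}_4:\mathbb{R}^2\to\mathbb{R}^3$, $$\mathfrak{B}_4(u,v)=\left(\tfrac13u^3-uv^2-\tfrac15u^5+2u^3v^2-uv^4,\; -u^2v+\tfrac13v^3-u^4v+2u^2v^3-\tfrac15v^5,\; \tfrac12u^4-3u^2v^2+\tfrac12v^4\right),$$ is an algebraic minimal surface of degree $\deg(\mathfrak{B}_4)=25$.
   Context: A parametrized surface $\mathbf{x}(u,v)=(x(u,v),y(u,v),z(u,v))$ in $\mathbb{R}^3$ is algebraic if it satisfies an implicit equation $f(x,y,z)=0$ for a nonzero polynomial $f$. Its implicit equation is obtained by eliminating $u,v$, i.e. it is the irreducible polynomial $f\in\mathbb{R}[x,y,z]$ (unique up to a nonzero constant factor) such that $f(x(u,v),y(u,v),z(u,v))=0$ for all $(u,v)$. The degree of the surface is the total degree $\deg f$ of this polynomial. A minimal surface is a surface whose mean curvature vanishes identically at its regular points; $\mathfrak{B}_4$ may have a branch point at $(u,v)=(0,0)$, where it is not regular. *)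

(* Defs.v *)
From mathcomp Require Import all_boot all_order all_algebra.
From mathcomp Require Import all_classical all_reals all_analysis.
From mathcomp Require mpoly.
(* The notations of mpoly clash with those of mathcomp-analysis. *)
Export -(notations) mpoly.
Export numFieldNormedType.Exports.

Set Implicit Arguments.
Unset Strict Implicit.
Unset Printing Implicit Defensive.

Import Order.TTheory GRing.Theory Num.Theory.
Local Open Scope ring_scope.

Section Vectors.
Variable R : realType.

Definition vec3 (a b c : R) : 'rV[R]_3 := \row_(i < 3) nth 0 [:: a; b; c] i.

Definition dot3 (a b : 'rV[R]_3) : R := \sum_(i < 3) a 0 i * b 0 i.

(* The library norm `|a| of a row vector is the sup norm. *)
Definition enorm3 (a : 'rV[R]_3) : R := Num.sqrt (dot3 a a).

Definition cross3 (a b : 'rV[R]_3) : 'rV[R]_3 :=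
  let a0 := a 0 (inord 0) in let a1 := a 0 (inord 1) in let a2 := a 0 (inord 2) in
  let b0 := b 0 (inord 0) in let b1 := b 0 (inord 1) in let b2 := b 0 (inord 2) in
  vec3 (a1 * b2 - a2 * b1) (a2 * b0 - a0 * b2) (a0 * b1 - a1 * b0).

End Vectors.

Section Surfaces.
Variable R : realType.
Implicit Types (X : R * R -> 'rV[R]_3) (p : R * R).

Definition partial_u X : R * R -> 'rV[R]_3 := fun p => 'D_(1, 0) X p.
Definition partial_v X : R * R -> 'rV[R]_3 := fun p => 'D_(0, 1) X p.

(* C^oo: every iterated directional derivative exists and is differentiable.
   Since 'D_w is a total operator, minimality below has to require this. *)
Definition smooth_map X : Prop :=
  forall (s : seq (R * R)) p,
    differentiable (foldr (fun w (Y : R * R -> 'rV[R]_3) => fun q : R * R => 'D_w Y q) X s) p.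

Definition regular_point X p : Prop :=
  cross3 (partial_u X p) (partial_v X p) <> 0.

Definition unit_normal X p : 'rV[R]_3 :=
  let n := cross3 (partial_u X p) (partial_v X p) in (enorm3 n)^-1 *: n.

(* E, F, G and L, M, N are the coefficients of the two fundamental forms. *)
Definition mean_curvature X p : R :=
  let Xu := partial_u X p in
  let Xv := partial_v X p in
  let n := unit_normal X p in
  let E := dot3 Xu Xu in
  let F := dot3 Xu Xv in
  let G := dot3 Xv Xv in
  let L := dot3 (partial_u (partial_u X) p) n in
  let M := dot3 (partial_v (partial_u X) p) n in
  let N := dot3 (partial_v (partial_v X) p) n in
  (L * G - 2 * M * F + N * E) / (2 * (E * G - F ^+ 2)).

Definition minimal_surface X : Prop :=
  smooth_map X /\ forall p, regular_point X p -> mean_curvature X p = 0.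

Definition irreducible_mpoly (f : mpoly 3 R) : Prop :=
  [/\ f != 0, f \isn't a GRing.unit &
      forall g h : mpoly 3 R, f = g * h ->
        g \is a GRing.unit \/ h \is a GRing.unit].

Definition vanishes_on X (f : mpoly 3 R) : Prop :=
  forall p, meval (X p 0) f = 0.

Definition algebraic_surface X : Prop :=
  exists2 f : mpoly 3 R, f != 0 & vanishes_on X f.

(* f is the irreducible equation of X, unique up to a nonzero constant. *)
Definition implicit_equation X (f : mpoly 3 R) : Prop :=
  [/\ irreducible_mpoly f, vanishes_on X f &
      forall g : mpoly 3 R, irreducible_mpoly g -> vanishes_on X g ->
        exists2 c : R, c != 0 & g = c *: f].

(* msize f is 1 + the total degree of f when f != 0. *)
Definition surface_degree X (d : nat) : Prop :=
  exists2 f : mpoly 3 R, implicit_equation X f & (mpoly.msize f).-1 = d.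

Definition bour4 (p : R * R) : 'rV[R]_3 :=
  let u := p.1 in let v := p.2 in
  vec3
    (3^-1 * u ^+ 3 - u * v ^+ 2 - 5^-1 * u ^+ 5 + 2 * u ^+ 3 * v ^+ 2 - u * v ^+ 4)
    (- (u ^+ 2 * v) + 3^-1 * v ^+ 3 - u ^+ 4 * v + 2 * u ^+ 2 * v ^+ 3 - 5^-1 * v ^+ 5)
    (2^-1 * u ^+ 4 - 3 * u ^+ 2 * v ^+ 2 + 2^-1 * v ^+ 4).

End Surfaces.

(* Main.v *)
(** Write [w = u + i v] and treat [s = w], [t = conj w] as independent complex
    variables: the surface becomes [x + i y = t^3/3 - s^5/5],
    [x - i y = s^3/3 - t^5/5], [z = (s^4 + t^4)/4].  Give [x, y, z] the weights
    5, 5, 4.  Multiplication by [z] is a 25 x 25 matrix over [C[x, y]] in the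
    spanning family [s^i t^j], [i, j < 5]; its characteristic polynomial has
    weight at most 100, hence total degree 25, and is monic in [z].  Conversely
    a nonzero equation of degree less than 25 in [z] would have a nonzero part of
    maximal weight vanishing on [(s^5, t^5, s^4 + t^4)], where fifth roots of
    unity give 25 values of [z] over a generic [(x, y)].  So Euclidean division
    by the monic equation shows that it generates the prime ideal of the surface.
    Minimality holds because the parametrization is harmonic and conformal. *)
Require Import Defs.
From HB Require Import structures.
From mathcomp Require Import all_boot all_order all_algebra.
From mathcomp Require Import all_classical all_reals all_analysis.
From mathcomp Require Import perm complex ring zify.

Set Implicit Arguments.
Unset Strict Implicit.
Unset Printing Implicit Defensive.

Import Order.TTheory GRing.Theory Num.Theory.
Local Open Scope ring_scope.

Local Notation mX i := (mpolyX _ (mnm1 i)).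

(** * Weighted degree bounds for multivariate polynomials *)

Section WeightBounds.
Variables (n : nat) (R : comNzRingType) (w : 'I_n -> nat).
Implicit Types (p q : mpoly n R) (m : multinom n).

Definition wdeg m : nat := (\sum_(i < n) w i * m i)%N.

(* The weight of [p] is at most [b - a], and [p = 0] when [b < a]. *)
Definition wbound (a b : nat) p : Prop :=
  forall m, m \in msupp p -> (wdeg m + a <= b)%N.

Lemma wdegD m1 m2 : wdeg (mnm_add m1 m2) = (wdeg m1 + wdeg m2)%N.
Proof.
by rewrite /wdeg -big_split; apply: eq_bigr => i _ /=; rewrite mnmDE mulnDr.
Qed.

Lemma wdeg0 : wdeg mnm0 = 0%N.
Proof. by rewrite /wdeg big1 // => i _; rewrite mnm0E muln0. Qed.

Lemma wdeg1 i : wdeg (mnm1 i) = w i.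
Proof.
rewrite /wdeg (bigD1 i) //= mnm1E eqxx muln1 big1 ?addn0 // => j ji.
by rewrite mnm1E eq_sym (negbTE ji) muln0.
Qed.

Lemma wboundP a b p :
  (forall m, mcoeff m p != 0 -> (wdeg m + a <= b)%N) <-> wbound a b p.
Proof. by split=> h m; move: (h m); rewrite mcoeff_msupp. Qed.

Lemma wbound_le a b a' b' p :
  (a' + b <= a + b')%N -> wbound a b p -> wbound a' b' p.
Proof. by move=> ab h m /h; lia. Qed.

Lemma wbound0 a b : wbound a b 0.
Proof. by move=> m; rewrite msupp0. Qed.

Lemma wboundC a b c : (a <= b)%N -> wbound a b (mpolyC n c).
Proof.
move=> ab m; rewrite msuppC; case: eqP => // _.
by rewrite inE => /eqP ->; rewrite wdeg0.
Qed.

Lemma wboundX m a b : (wdeg m + a <= b)%N -> wbound a b (mpolyX R m).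
Proof. by move=> ab m'; rewrite msuppX inE => /eqP ->. Qed.

Lemma wboundD a b p q : wbound a b p -> wbound a b q -> wbound a b (p + q).
Proof.
by move=> hp hq m /msuppD_le; rewrite mem_cat => /orP [/hp|/hq].
Qed.

Lemma wboundN a b p : wbound a b p -> wbound a b (- p).
Proof. by move=> h m; rewrite (perm_mem (msuppN p)) => /h. Qed.

Lemma wboundB a b p q : wbound a b p -> wbound a b q -> wbound a b (p - q).
Proof. by move=> hp hq; apply: wboundD => //; apply: wboundN. Qed.

Lemma wboundZ a b c p : wbound a b p -> wbound a b (c *: p).
Proof. by move=> h m /msuppZ_le /h. Qed.

Lemma wboundM a b a' b' p q :
  wbound a b p -> wbound a' b' q -> wbound (a + a') (b + b') (p * q).
Proof.
move=> hp hq m /msuppM_le /allpairsP [[m1 m2] /= [/hp h1 /hq h2 ->]].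
by rewrite wdegD addnACA leq_add.
Qed.

Lemma wbound_sum a b I (r : seq I) (P : pred I) (F : I -> mpoly n R) :
  (forall i, P i -> wbound a b (F i)) -> wbound a b (\sum_(i <- r | P i) F i).
Proof.
move=> h; elim/big_ind: _ => //; first exact: wbound0.
by move=> *; apply: wboundD.
Qed.

Lemma wbound_prod I (r : seq I) (P : pred I) (a b : I -> nat)
    (F : I -> mpoly n R) :
  (forall i, P i -> wbound (a i) (b i) (F i)) ->
  wbound (\sum_(i <- r | P i) a i) (\sum_(i <- r | P i) b i)
    (\prod_(i <- r | P i) F i).
Proof.
move=> h; elim/big_rec3: _ => [|i p y x Pi IH]; first exact: wboundC.
by apply: wboundM => //; apply: h.
Qed.

End WeightBounds.

(** * Functions of one variable given by polynomials *)

Section PolynomialFunctions.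
Variable K : numDomainType.
Implicit Types (f g : K -> K).

Definition polyfun f := exists p : {poly K}, forall x, f x = p.[x].

Lemma polyfun_ext f g : f =1 g -> polyfun f -> polyfun g.
Proof. by move=> fg [p hp]; exists p => x; rewrite -fg. Qed.

Lemma polyfun_cst c : polyfun (fun=> c).
Proof. by exists c%:P => x; rewrite hornerC. Qed.

Lemma polyfun_id : polyfun id.
Proof. by exists 'X => x; rewrite hornerX. Qed.

Lemma polyfunD f g : polyfun f -> polyfun g -> polyfun (fun x => f x + g x).
Proof. by move=> [p hp] [q hq]; exists (p + q) => x; rewrite hornerD hp hq. Qed.

Lemma polyfunM f g : polyfun f -> polyfun g -> polyfun (fun x => f x * g x).
Proof. by move=> [p hp] [q hq]; exists (p * q) => x; rewrite hornerM hp hq. Qed.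

Lemma polyfunN f : polyfun f -> polyfun (fun x => - f x).
Proof. by move=> [p hp]; exists (- p) => x; rewrite hornerN hp. Qed.

Lemma polyfunX f k : polyfun f -> polyfun (fun x => f x ^+ k).
Proof. by move=> [p hp]; exists (p ^+ k) => x; rewrite horner_exp hp. Qed.

Lemma polyfun_sum I (r : seq I) (F : I -> K -> K) :
  (forall i, polyfun (F i)) -> polyfun (fun x => \sum_(i <- r) F i x).
Proof.
move=> h; elim: r => [|i r IH].
  by apply: polyfun_ext (polyfun_cst 0) => x; rewrite big_nil.
by apply: polyfun_ext (polyfunD (h i) IH) => x; rewrite big_cons.
Qed.

Lemma polyfun_prod I (r : seq I) (F : I -> K -> K) :
  (forall i, polyfun (F i)) -> polyfun (fun x => \prod_(i <- r) F i x).
Proof.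
move=> h; elim: r => [|i r IH].
  by apply: polyfun_ext (polyfun_cst 1) => x; rewrite big_nil.
by apply: polyfun_ext (polyfunM (h i) IH) => x; rewrite big_cons.
Qed.

Lemma polyfun_meval n (g : mpoly n K) (v : K -> 'I_n -> K) :
  (forall i, polyfun (fun x => v x i)) -> polyfun (fun x => meval (v x) g).
Proof.
move=> h; apply: polyfun_ext (fun x => esym (mevalE _ _)) _.
apply: polyfun_sum => m; apply: polyfunM; first exact: polyfun_cst.
by apply: polyfun_prod => i; apply: polyfunX.
Qed.

(** The positive integers are infinitely many distinct roots. Leaving out 0 lets later arguments
    divide by the test point. *)
Lemma poly_nat_eq0 (p : {poly K}) : (forall n, p.[n.+1%:R] = 0) -> p = 0.
Proof.
move=> h; apply/eqP/negPn/negP => p0.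
pose rs := [seq i.+1%:R : K | i <- iota 0 (size p)].
have := max_poly_roots p0 (rs := rs); rewrite size_map size_iota ltnn.
move=> H; suff: false by []; apply: H; last first.
  rewrite map_inj_uniq ?iota_uniq // => i j /eqP.
  by rewrite eqr_nat => /eqP [].
by apply/allP => _ /mapP [i _ ->]; rewrite /root h.
Qed.

Lemma polyfun_eq0 f : polyfun f -> (forall n, f n.+1%:R = 0) -> forall x, f x = 0.
Proof.
move=> [p hp] h x; rewrite hp (@poly_nat_eq0 p) ?horner0 // => n.
by rewrite -hp.
Qed.

Lemma polyfun_mul0 f g : polyfun f -> polyfun g -> (forall x, f x * g x = 0) ->
  (forall x, f x = 0) \/ (forall x, g x = 0).
Proof.
move=> [p hp] [q hq] h.
have /eqP : p * q = 0.
  by apply: poly_nat_eq0 => n; rewrite hornerM -hp -hq.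
rewrite mulf_eq0 => /orP [] /eqP E; [left|right] => x.
  by rewrite hp E horner0.
by rewrite hq E horner0.
Qed.

End PolynomialFunctions.

(** * Polynomials in three variables and their values *)

Definition pt3 (K : pzRingType) (x y z : K) : 'I_3 -> K :=
  fun i => nth 0 [:: x; y; z] i.

Definition o0 : 'I_3 := Ordinal (isT : 0 < 3)%N.
Definition o1 : 'I_3 := Ordinal (isT : 1 < 3)%N.
Definition o2 : 'I_3 := Ordinal (isT : 2 < 3)%N.

Lemma big3E (T : Type) (idx : T) (op : Monoid.law idx) (F : 'I_3 -> T) :
  \big[op/idx]_(i < 3) F i = op (F o0) (op (F o1) (F o2)).
Proof.
rewrite !big_ord_recl big_ord0 Monoid.mulm1.
by congr (op (F _) (op (F _) (F _))); apply: val_inj.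
Qed.

Lemma I3P (P : 'I_3 -> Prop) : P o0 -> P o1 -> P o2 -> forall i, P i.
Proof.
move=> h0 h1 h2 [[|[|[|//]]] hi].
- by rewrite (_ : Ordinal hi = o0) //; apply: val_inj.
- by rewrite (_ : Ordinal hi = o1) //; apply: val_inj.
- by rewrite (_ : Ordinal hi = o2) //; apply: val_inj.
Qed.

Lemma mevalE3 (K : comNzRingType) (v : 'I_3 -> K) (p : mpoly 3 K) :
  meval v p =
  \sum_(m <- msupp p) mcoeff m p * (v o0 ^+ m o0 * (v o1 ^+ m o1 * v o2 ^+ m o2)).
Proof. by rewrite mevalE; apply: eq_bigr => m _; rewrite big3E. Qed.

Lemma meval_sum (n : nat) (K : comNzRingType) (v : 'I_n -> K) I (r : seq I)
    (F : I -> mpoly n K) :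
  meval v (\sum_(i <- r) F i) = \sum_(i <- r) meval v (F i).
Proof. by rewrite (big_morph (meval v) (mevalD v) (meval0 v)). Qed.

Lemma mcoeff_sumX (n : nat) (R : nzRingType) (r : seq (multinom n))
    (c : multinom n -> R) m : uniq r ->
  mcoeff m (\sum_(m' <- r) c m' *: mpolyX R m') = if m \in r then c m else 0.
Proof.
move=> ru; rewrite raddf_sum /=.
rewrite (eq_bigr (fun m' => if m' == m then c m else 0)); last first.
  move=> m' _; rewrite mcoeffZ mcoeffX.
  by case: eqP => [->|_]; rewrite ?mulr1 ?mulr0.
case: ifPn => mr.
  rewrite (bigD1_seq m) //= eqxx big1 ?addr0 //.
  by move=> m' /negbTE ->.
rewrite big_seq big1 // => m' m'r; case: eqP => // E.
by move: mr; rewrite -E m'r.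
Qed.

Lemma polyfun_meval3 (K : numDomainType) (g : mpoly 3 K) (x y z : K -> K) :
  polyfun x -> polyfun y -> polyfun z ->
  polyfun (fun c => meval (pt3 (x c) (y c) (z c)) g).
Proof. by move=> hx hy hz; apply: polyfun_meval; apply: I3P. Qed.

(* Kronecker substitution: [x, y, z := t, t ^ N, t ^ (N ^ 2)] separates the
   monomials of [g]. *)
Lemma mpoly3_eq0 (K : numDomainType) (g : mpoly 3 K) :
  (forall x y z, meval (pt3 x y z) g = 0) -> g = 0.
Proof.
move=> h.
pose N := (\max_(m <- msupp g) \max_(i < 3) (m i : nat)).+1%N.
have hN m i : m \in msupp g -> (m i < N)%N.
  move=> mg; rewrite ltnS.
  apply: leq_trans (leq_bigmax_seq
    (F := fun m : multinom 3 => \max_(i < 3) (m i : nat)) m mg isT).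
  exact: (leq_bigmax (F := fun i => m i)).
pose e (m : multinom 3) := (m o0 + N * (m o1 + N * m o2))%N.
have einj m m' : m \in msupp g -> m' \in msupp g -> e m = e m' -> m = m'.
  move=> mg mg' E.
  (* Uniqueness of the lowest digit in base [N], applied twice to the digits of [e m]. *)
  have modN a b c d : (a < N)%N -> (c < N)%N ->
      (a + N * b = c + N * d)%N -> a = c /\ b = d.
    move=> aN cN E'; have ac : a = c.
      have := congr1 (modn^~ N) E'.
      by rewrite /= ![(N * _)%N]mulnC ![(_ + _ * N)%N]addnC !modnMDl !modn_small.
    split=> //; move: E'; rewrite ac => /addnI /eqP.
    by rewrite eqn_mul2l (gtn_eqF (leq_ltn_trans _ aN)) // => /eqP.
  have [E0 E'] := modN _ _ _ _ (hN _ _ mg) (hN _ _ mg') E.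
  have [E1 E2] := modN _ _ _ _ (hN _ _ mg) (hN _ _ mg') E'.
  by apply/mnmP; apply: I3P.
pose p : {poly K} := \sum_(m <- msupp g) mcoeff m g *: 'X^(e m).
have p0 : p = 0.
  apply: poly_nat_eq0 => k; set t := k.+1%:R.
  rewrite -(h t (t ^+ N) (t ^+ N ^+ N)) mevalE3 /p horner_sum.
  apply: eq_bigr => m _; rewrite hornerZ hornerXn /e /pt3 /=.
  by rewrite -!exprM -!exprD; congr (_ * _ ^+ _); lia.
apply/mpolyP => m; rewrite mcoeff0; apply/eqP; rewrite mcoeff_eq0.
apply/negP => mg.
have /eqP : p`_(e m) = 0 by rewrite p0 coef0.
rewrite /p coef_sum (bigD1_seq m) ?msupp_uniq //= big_seq_cond big1 ?addr0.
  by rewrite coefZ coefXn eqxx mulr1 mcoeff_eq0 mg.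
move=> m' /andP [mg' mm']; rewrite coefZ coefXn.
case: (eqVneq (e m) (e m')) => [E|_]; last by rewrite mulr0.
by move: mm'; rewrite (einj _ _ mg mg' E) eqxx.
Qed.

(** * The complexified surface and its equation monic in [z] *)

Section ComplexCurve.
Variable K : numClosedFieldType.
Implicit Types (s t x y z : K) (f g r : mpoly 3 K).

(* With [s = u + i v] and [t = u - i v] made independent, Bour's surface is
   [x + i y = curveA s t], [x - i y = curveA t s], [z = (s ^ 4 + t ^ 4) / 4]. *)
Definition curveA s t : K := 3^-1 * t ^+ 3 - 5^-1 * s ^+ 5.

Definition curve s t : 'I_3 -> K :=
  pt3 ((curveA s t + curveA t s) / 2) ((curveA s t - curveA t s) / (2 * 'i))
    (4^-1 * (s ^+ 4 + t ^+ 4)).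

Definition w554 (i : 'I_3) : nat := nth 0%N [:: 5; 5; 4]%N i.

Definition mXY (c : K) : mpoly 3 K := mX o0 + c *: mX o1.

Lemma meval_mXYi s t : meval (curve s t) (mXY 'i) = curveA s t.
Proof.
rewrite mevalD mevalZ !mevalXU /curve /pt3 /=.
by field; exact: neq0Ci.
Qed.

Lemma meval_mXYNi s t : meval (curve s t) (mXY (- 'i)) = curveA t s.
Proof.
rewrite mevalD mevalZ !mevalXU /curve /pt3 /=.
by field; exact: neq0Ci.
Qed.

Lemma wbound_mXY c : wbound w554 0 5 (mXY c).
Proof.
by apply: wboundD; last apply: wboundZ; apply: wboundX; rewrite wdeg1.
Qed.

(* Restriction to the line [x = y = 0]. *)
Definition zpoly : mpoly 3 K -> {poly K} := mmap polyC (pt3 0 0 'X).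

HB.instance Definition _ :=
  GRing.RMorphism.copy zpoly (mmap polyC (pt3 0 0 'X)).

Lemma zpolyZ c g : zpoly (c *: g) = c%:P * zpoly g.
Proof. exact: mmapZ. Qed.

Lemma zpolyD f g : zpoly (f + g) = zpoly f + zpoly g.
Proof. exact: rmorphD. Qed.

Lemma zpolyB f g : zpoly (f - g) = zpoly f - zpoly g.
Proof. exact: rmorphB. Qed.

Lemma zpolyM f g : zpoly (f * g) = zpoly f * zpoly g.
Proof. exact: rmorphM. Qed.

Lemma size_zpoly_mXY c : (size (zpoly (mXY c)) <= 1)%N.
Proof.
rewrite /zpoly mmapD mmapZ !mmapX !mmap1U /pt3 /= mulr0 addr0.
by rewrite size_poly0.
Qed.

(** The index [k] encodes the exponents [k %/ 5] of [s] and [k %% 5] of [t]. *)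
Definition bw (k : 'I_25) : nat := (k %/ 5 + k %% 5)%N.

Definition bmon s t (k : 'I_25) : K := s ^+ (k %/ 5) * t ^+ (k %% 5).

(* [s ^ 5] and [t ^ 5] are lower order terms modulo [x + i y] and [x - i y]. *)
Lemma bmon_span (i j : nat) :
  exists c : 'I_25 -> mpoly 3 K,
    [/\ forall k, wbound w554 (bw k) (i + j) (c k),
        forall k, (size (zpoly (c k)) <= 1)%N
      & forall s t, s ^+ i * t ^+ j
          = \sum_k meval (curve s t) (c k) * bmon s t k].
Proof.
have [n ijn] := ubnP (i + j)%N; elim: n => // n IH in i j ijn *.
(* From [s ^ 5 = 5/3 t ^ 3 - 5 (x + i y)], and its mirror image in [t]: one term loses 2 in degree,
   the other loses 5, which is the weight of the factor [b]. *)
have step (i1 j1 i2 j2 : nat) (b : mpoly 3 K) :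
    (i1 + j1 < n)%N -> (i2 + j2 < n)%N ->
    (i1 + j1 <= i + j)%N -> (i2 + j2 + 5 <= i + j)%N ->
    wbound w554 0 5 b -> (size (zpoly b) <= 1)%N ->
    (forall s t, s ^+ i * t ^+ j = 5 / 3 * (s ^+ i1 * t ^+ j1)
       - 5 * meval (curve s t) b * (s ^+ i2 * t ^+ j2)) ->
    exists c : 'I_25 -> mpoly 3 K,
    [/\ forall k, wbound w554 (bw k) (i + j) (c k),
        forall k, (size (zpoly (c k)) <= 1)%N
      & forall s t, s ^+ i * t ^+ j
          = \sum_k meval (curve s t) (c k) * bmon s t k].
  move=> h1 h2 l1 l2 wb zb E.
  have [c1 [w1 z1 e1]] := IH _ _ h1; have [c2 [w2 z2 e2]] := IH _ _ h2.
  exists (fun k => (5 / 3) *: c1 k - 5 *: (b * c2 k)); split.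
  - move=> k; apply: wboundB; apply: wboundZ.
      by apply: wbound_le (w1 k); rewrite leq_add2l.
    apply: wbound_le (wboundM wb (w2 k)).
    by rewrite add0n leq_add2l addnC.
  - move=> k; rewrite zpolyB !zpolyZ zpolyM.
    rewrite (size1_polyC (z1 k)) (size1_polyC (z2 k)) (size1_polyC zb).
    by rewrite -!polyCM -polyCB size_polyC leq_b1.
  - move=> s t; rewrite E e1 e2 [5 / 3 * _]mulr_sumr [5 * _ * _]mulr_sumr -sumrB.
    apply: eq_bigr => k _.
    by rewrite mevalB !mevalZ mevalM; ring.
have [i5|i5] := leqP 5 i.
  apply: (step (i - 5) (j + 3) (i - 5) j (mXY 'i))%N; try lia.
  - exact: wbound_mXY.
  - exact: size_zpoly_mXY.
  - move=> s t; rewrite meval_mXYi /curveA.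
    rewrite -{1}(subnK i5) !exprD; by field.
have [j5|j5] := leqP 5 j.
  apply: (step (i + 3) (j - 5) i (j - 5) (mXY (- 'i)))%N; try lia.
  - exact: wbound_mXY.
  - exact: size_zpoly_mXY.
  - move=> s t; rewrite meval_mXYNi /curveA.
    rewrite -{1}(subnK j5) !exprD; by field.
(* Both exponents are now below 5, so the monomial belongs to the family. *)
have hk : (i * 5 + j < 25)%N by lia.
pose k0 : 'I_25 := Ordinal hk.
have [d m] : (k0 %/ 5 = i)%N /\ (k0 %% 5 = j)%N by move=> /=; lia.
exists (fun k => if k == k0 then 1 else 0); split.
- move=> k; case: eqP => [->|_]; last exact: wbound0.
  by apply: wboundC; rewrite /bw d m.
- move=> k; case: eqP => _.
    by rewrite rmorph1 size_poly1.
  by rewrite rmorph0 size_poly0.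
move=> s t; rewrite (bigD1 k0) //= eqxx big1 ?addr0.
  by rewrite rmorph1 mul1r /bmon d m.
by move=> k /negbTE ->; rewrite rmorph0 mul0r.
Qed.

(** Provides row [k] of the matrix of multiplication by [z], which has degree 4 in [s] and [t]. *)
Lemma z4_span (k : 'I_25) :
  exists c : 'I_25 -> mpoly 3 K,
    [/\ forall l, wbound w554 (bw l) (bw k + 4) (c l),
        forall l, (size (zpoly (c l)) <= 1)%N
      & forall s t, 4^-1 * (s ^+ 4 + t ^+ 4) * bmon s t k
          = \sum_l meval (curve s t) (c l) * bmon s t l].
Proof.
have [c1 [w1 z1 e1]] := bmon_span (k %/ 5 + 4) (k %% 5).
have [c2 [w2 z2 e2]] := bmon_span (k %/ 5) (k %% 5 + 4).
exists (fun l => 4^-1 *: (c1 l + c2 l)); split.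
- move=> l; apply: wboundZ; apply: wboundD.
    by apply: wbound_le (w1 l); rewrite /bw; lia.
  by apply: wbound_le (w2 l); rewrite /bw; lia.
- move=> l; rewrite zpolyZ zpolyD.
  rewrite (size1_polyC (z1 l)) (size1_polyC (z2 l)).
  by rewrite -polyCD -polyCM size_polyC leq_b1.
- move=> s t; rewrite /bmon.
  rewrite (_ : _ * _ = 4^-1 * (s ^+ (k %/ 5 + 4) * t ^+ (k %% 5)
     + s ^+ (k %/ 5) * t ^+ (k %% 5 + 4))); last by rewrite !exprD; ring.
  rewrite e1 e2 -big_split mulr_sumr; apply: eq_bigr => l _ /=.
  by rewrite mevalZ mevalD /bmon; ring.
Qed.

Definition zmon (k : nat) : multinom 3 := mnm_muln (mnm1 o2) k.

Lemma zmonE k i : zmon k i = ((i == o2) * k)%N.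
Proof. by rewrite mulmnE mnm1E eq_sym. Qed.

(** Only the pure powers of [z] survive on the line [x = y = 0]. *)
Lemma coef_zpoly f k : (zpoly f)`_k = mcoeff (zmon k) f.
Proof.
have coefm (m : multinom 3) :
    (polyC (mcoeff m f) * mmap1 (pt3 0 0 'X) m)`_k
    = if m == zmon k then mcoeff m f else 0.
  rewrite /mmap1 big3E /pt3 /= coefCM.
  case: eqP => [->|mz].
    by rewrite !zmonE /= !expr0 !mul1r mul1n coefXn eqxx mulr1.
  case E0: (m o0) => [|a]; last by rewrite exprS !mul0r coef0 mulr0.
  case E1: (m o1) => [|a]; last by rewrite exprS !(mul0r, mulr0) coef0 mulr0.
  rewrite !expr0 !mul1r coefXn; case: eqP => [E2|]; last by rewrite mulr0.
  by case: mz; apply/mnmP; apply: I3P; rewrite zmonE /= ?E0 ?E1 ?E2 ?mul1n.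
rewrite /zpoly /mmap coef_sum; under eq_bigr do rewrite coefm.
have [zf|zf] := boolP (zmon k \in msupp f).
  rewrite (bigD1_seq (zmon k)) ?msupp_uniq //= eqxx big1 ?addr0 //.
  by move=> m /negbTE ->.
rewrite (memN_msupp_eq0 zf) big_seq big1 // => m mf.
by case: eqP => // E; move: zf; rewrite -E mf.
Qed.

Lemma curve_equation :
  exists f, [/\ forall s t, meval (curve s t) f = 0, wbound w554 0 100 f
    & mcoeff (zmon 25) f = 1].
Proof.
have [c hc] := fin_all_exists z4_span.
pose D : 'M[mpoly 3 K]_25 := (mX o2)%:M - \matrix_(k, l) c k l.
exists (\det D); split.
- move=> s t; rewrite -[meval _ _]/((meval (curve s t) : {rmorphism _ -> _}) _).
  (* The monomials [bmon s t] form a kernel vector, nonzero because its entry of index 0 is 1.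
     [det0P] wants a left kernel, hence the transpose. *)
  rewrite -det_map_mx -det_tr; apply/eqP/det0P.
  exists (\row_l bmon s t l).
    apply/negP => /eqP /rowP /(_ 0) /eqP.
    by rewrite !mxE /bmon /= !expr0 mulr1 oner_eq0.
  apply/rowP => k; rewrite !mxE.
  have [_ _ e] := hc k.
  transitivity (4^-1 * (s ^+ 4 + t ^+ 4) * bmon s t k
      - \sum_l meval (curve s t) (c k l) * bmon s t l); last by rewrite e subrr.
  rewrite (eq_bigr (fun l => (k == l)%:R * (4^-1 * (s ^+ 4 + t ^+ 4)) * bmon s t l
      - meval (curve s t) (c k l) * bmon s t l)).
    rewrite sumrB (bigD1 k) //= eqxx mul1r big1 ?addr0 // => l.
    by rewrite eq_sym => /negbTE ->; rewrite !mul0r.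
  move=> l _; rewrite !mxE /= mevalB mevalMn mevalXU /curve /pt3 /=.
  by rewrite -mulr_natl; ring.
(* Entry [(i, j)] has weight at most [bw i + 4 - bw j]. Along a permutation the [bw] terms cancel,
   leaving 25 * 4 = 100. *)
- have wD i j : wbound w554 (bw j) (bw i + 4) (D i j).
    rewrite !mxE; apply: wboundB; last by have [h _ _] := hc i; apply: h.
    case: eqP => [->|_]; last exact: wbound0.
    by apply: wboundX; rewrite wdeg1 /= addnC.
  apply: wbound_sum => σ _; rewrite -signr_odd.
  have h : wbound w554 0 100 (\prod_i D i (σ i)).
    apply: wbound_le (wbound_prod (fun i _ => wD i (σ i))).
    rewrite big_split /= sum_nat_const card_ord.
    rewrite -(reindex_inj (perm_inj (s := σ)) (P := xpredT) (F := bw)) /=.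
    by rewrite add0n addnC.
  by case: (odd _); rewrite ?expr1 ?expr0 ?mulN1r ?mul1r //; apply: wboundN.
(* On the line [x = y = 0] the coefficients are constants, so the determinant becomes the
   characteristic polynomial of a scalar matrix, monic of degree 25. *)
- rewrite -coef_zpoly -[zpoly _]/((zpoly : {rmorphism _ -> _}) _) -det_map_mx.
  pose N : 'M[K]_25 := \matrix_(k, l) (zpoly (c k l))`_0.
  have -> : map_mx zpoly D = char_poly_mx N.
    apply/matrixP => k l; rewrite !mxE zpolyB.
    have [_ h _] := hc k; rewrite {1}(size1_polyC (h l)); congr (_ - _).
    rewrite /zpoly mmapMn mmapX mmap1U /pt3 /=.
    by rewrite mulrb.
  have := char_poly_monic N; rewrite monicE /lead_coef size_char_poly.
  by move/eqP.
Qed.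

End ComplexCurve.

(** * Forms of maximal weight, and fifth roots of unity *)

Section TopForm.
Variable K : numClosedFieldType.
Implicit Types (s t x y z : K) (f g r : mpoly 3 K).

(** This is [c ^ 5 * curveA (s / c) (t / c)] with denominators cleared, so that [c = 0] makes
    sense. *)
Definition scurveA (c s t : K) : K := 3^-1 * c ^+ 2 * t ^+ 3 - 5^-1 * s ^+ 5.

(* The curve rescaled by the weights [w554]; its limit [c = 0] keeps the leading
   forms only. *)
Definition scurve (c s t : K) : 'I_3 -> K :=
  pt3 ((scurveA c s t + scurveA c t s) / 2)
    ((scurveA c s t - scurveA c t s) / (2 * 'i)) (4^-1 * (s ^+ 4 + t ^+ 4)).

Lemma scurveE c s t i : c != 0 ->
  scurve c s t i = c ^+ w554 i * curve (s / c) (t / c) i.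
Proof.
move=> c0; have i0 := neq0Ci K; move: i; apply: I3P;
  rewrite /scurve /curve /pt3 /w554 /scurveA /curveA /=; field; rewrite ?c0 ?i0 ?andbT //.
Qed.

Lemma polyfun_scurve (c a b : K -> K) i :
  polyfun c -> polyfun a -> polyfun b ->
  polyfun (fun x => scurve (c x) (a x) (b x) i).
Proof.
move=> hc.
have pA a' b' : polyfun a' -> polyfun b' ->
    polyfun (fun x => scurveA (c x) (a' x) (b' x)).
  move=> ha hb; apply: polyfunD.
    apply: polyfunM; last exact: polyfunX.
    by apply: polyfunM; [apply: polyfun_cst|apply: polyfunX].
  by apply: polyfunN; apply: polyfunM; [apply: polyfun_cst|apply: polyfunX].
move=> ha hb; move: i; apply: I3P; rewrite /scurve /pt3 /=.
- apply: polyfunM; last exact: polyfun_cst.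
  by apply: polyfunD; apply: pA.
- apply: polyfunM; last exact: polyfun_cst.
  by apply: polyfunD; last apply: polyfunN; apply: pA.
- apply: polyfunM; first exact: polyfun_cst.
  by apply: polyfunD; apply: polyfunX.
Qed.

(** Since [0 ^+ k] is 1 for [k = 0] and 0 otherwise, the part of weight [d] is kept when [d] bounds
    the weight of [g]. Powers of 0 make it the value at [c = 0] of a family polynomial in [c]. *)
Definition topform (d : nat) g : mpoly 3 K :=
  \sum_(m <- msupp g) (mcoeff m g * 0 ^+ (d - wdeg w554 m)) *: mpolyX K m.

Lemma mcoeff_topform d g m :
  mcoeff m (topform d g) = mcoeff m g * 0 ^+ (d - wdeg w554 m).
Proof.
rewrite mcoeff_sumX ?msupp_uniq //; case: ifPn => // /memN_msupp_eq0 ->.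
by rewrite mul0r.
Qed.

Lemma topform_vanishes d g :
  wbound w554 0 d g -> (forall s t, meval (curve s t) g = 0) ->
  forall s t, meval (scurve 0 s t) (topform d g) = 0.
Proof.
move=> wg hg s t.
(* For [c != 0], [Q c] is [c ^ d] times a value of [g] on the surface, hence 0. Being polynomial in
   [c], it is also 0 at [c = 0]. *)
pose Q c := \sum_(m <- msupp g) mcoeff m g * c ^+ (d - wdeg w554 m)
  * \prod_(i < 3) scurve c s t i ^+ m i.
have Qpoly : polyfun Q.
  apply: polyfun_sum => m; apply: polyfunM.
    by apply: polyfunM; [apply: polyfun_cst|apply/polyfunX/polyfun_id].
  apply: polyfun_prod => i; apply/polyfunX/(polyfun_scurve _ (@polyfun_id _));
    exact: polyfun_cst.
rewrite (_ : meval _ _ = Q 0); last first.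
  rewrite /topform /Q meval_sum; apply: eq_bigr => m _ /=.
  by rewrite mevalZ mevalX.
apply: (polyfun_eq0 Qpoly) => n; set c := n.+1%:R.
have c0 : c != 0 by rewrite pnatr_eq0.
transitivity (c ^+ d * meval (curve (s / c) (t / c)) g); last by rewrite hg mulr0.
rewrite /Q mevalE mulr_sumr.
rewrite !big_seq; apply: eq_bigr => m /wg; rewrite addn0 => md.
rewrite (eq_bigr (fun i => c ^+ (w554 i * m i) * curve (s / c) (t / c) i ^+ m i)).
  rewrite big_split /= -expr_sum -/(wdeg w554 m) -{2}(subnK md) exprD.
  by move: (c ^+ (d - _)) (c ^+ wdeg _ _) => a b; ring.
by move=> i _; rewrite scurveE // exprMn exprM.
Qed.

Lemma prim_root5 : exists w : K, 5.-primitive_root w.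
Proof.
(* A root of [X^4 + X^3 + X^2 + X + 1]. Its order divides 5, and order 1 would give 5 = 0. *)
have [w hw] := @solve_monicpoly K 4 (fun=> -1) isT.
rewrite !big_ord_recl big_ord0 /= addr0 !mulN1r /bump /= in hw.
have w5 : w ^+ 5 = 1.
  have -> : w ^+ 5 = w * w ^+ 4 by rewrite exprS.
  by rewrite {1}hw; ring: hw.
have [m wm m5] := prim_order_exists (isT : 0 < 5)%N w5.
exists w; suff -> : 5%N = m by [].
have : m \in divisors 5 by rewrite -dvdn_divisors.
rewrite [divisors 5]/= !inE => /orP [] /eqP E; last by rewrite E.
move: wm; rewrite E => /prim_expr_order; rewrite expr1 => w1.
move: hw; rewrite w1 !expr1n => /eqP.
by rewrite -subr_eq0 (_ : _ - _ = 5); [rewrite pnatr_eq0|ring].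
Qed.

End TopForm.

(** * No nonzero equation of degree below 25 in [z] *)

Section Rigidity.
Variable K : numClosedFieldType.
Implicit Types (s t x y z : K) (f g r : mpoly 3 K).

Lemma scurveA0 s t : scurveA 0 s t = - 5^-1 * s ^+ 5.
Proof. by rewrite /scurveA expr0n /=; ring. Qed.

Definition fiber_pt s t z : 'I_3 -> K :=
  pt3 (scurve 0 s t o0) (scurve 0 s t o1) z.

(* For [s != 0] and all but finitely many [t] the line over the point [(s, t)]
   meets the leading-form surface in 25 points: multiply [s] and [t] by fifth
   roots of unity. *)
Lemma meval_fiber_pt_neq0 g :
  (forall m, m \in msupp g -> (m o2 < 25)%N) ->
  (forall s t, meval (scurve 0 s t) g = 0) ->
  forall s t z, s != 0 -> meval (fiber_pt s t z) g = 0.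
Proof.
move=> zg hg s t z s0; have [w pw] := prim_root5 K.
have w5 := prim_expr_order pw.
have winj (i j : 'I_5) : w ^+ i = w ^+ j -> i = j.
  move/eqP; rewrite (eq_prim_root_expr pw) !modn_small // => /eqP E.
  exact: val_inj.
(* The values of [t ^ 4] at which two of the 25 heights can coincide. A zero denominator gives
   [e q = 0], which only excludes [t = 0]. *)
pose e (q : ('I_5 * 'I_5) * ('I_5 * 'I_5)) : K :=
  s ^+ 4 * (w ^+ q.1.1 - w ^+ q.1.2) / (w ^+ q.2.2 - w ^+ q.2.1).
pose h : {poly K} := \prod_q ('X^4 - (e q)%:P).
have h0 : h != 0.
  by apply/monic_neq0/monic_prod => q _; apply: monicXnsubC.
have pf : polyfun (fun t => meval (fiber_pt s t z) g).
  apply: polyfun_meval3; last exact: polyfun_cst.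
  - by apply: (polyfun_scurve _ _ _ (@polyfun_id _)); apply: polyfun_cst.
  - by apply: (polyfun_scurve _ _ _ (@polyfun_id _)); apply: polyfun_cst.
have ph : polyfun (horner h) by exists h.
(* As [h] is a nonzero polynomial, it suffices that the product with [h.[t]] vanishes for every [t],
   so the roots of [h] may be set aside. *)
have [//|{}ph|hh] := polyfun_mul0 pf ph; last first.
- by move: h0; rewrite (@poly_nat_eq0 _ h) ?eqxx.
- exact: ph.
move=> {}t; have [->|ht] := eqVneq h.[t] 0; first by rewrite mulr0.
have te q : t ^+ 4 != e q.
  apply: contraNneq ht => E; rewrite /h horner_prod (bigD1 q) //=.
  by rewrite hornerD hornerN hornerXn hornerC E subrr mul0r.
pose p : {poly K} := \sum_(m <- msupp g)
  (mcoeff m g * (scurve 0 s t o0 ^+ m o0 * scurve 0 s t o1 ^+ m o1)) *: 'X^(m o2).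
have pE c : p.[c] = meval (fiber_pt s t c) g.
  rewrite mevalE3 /p horner_sum; apply: eq_bigr => m _.
  by rewrite hornerZ hornerXn !mulrA.
have sp : (size p <= 25)%N.
  rewrite /p big_seq; apply: (leq_trans (size_sum _ _ _)).
  apply/bigmax_leqP_seq => m _ mg.
  by apply: leq_trans (size_scale_leq _ _) _; rewrite size_polyXn zg.
pose c (q : 'I_5 * 'I_5) : K := 4^-1 * (w ^+ q.1 * s ^+ 4 + w ^+ q.2 * t ^+ 4).
rewrite -pE; suff -> : p = 0 by rewrite horner0 mul0r.
apply: (@roots_geq_poly_eq0 _ p [seq c q | q <- enum {: 'I_5 * 'I_5}]).
- apply/allP => _ /mapP [[i j] _ ->]; rewrite /root pE.
  (* These multiples keep [s ^ 5] and [t ^ 5], hence [x] and [y], while fourth powers are multiplied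
     by [w ^ i] and [w ^ j], because 16 = 1 modulo 5. *)
  rewrite -(hg (w ^+ (4 * i) * s) (w ^+ (4 * j) * t)).
  have pow5 (k : nat) a : (w ^+ (4 * k) * a) ^+ 5 = a ^+ 5.
    by rewrite exprMn -exprM [(4 * k * 5)%N]mulnC exprM w5 expr1n mul1r.
  have pow4 (k : nat) a : (w ^+ (4 * k) * a) ^+ 4 = w ^+ k * a ^+ 4.
    rewrite exprMn -exprM (_ : (4 * k * 4 = 5 * (3 * k) + k)%N); last lia.
    by rewrite exprD exprM w5 expr1n mul1r.
  apply/eqP/meval_eq; apply: I3P;
    by rewrite /fiber_pt /scurve /pt3 /= ?scurveA0 ?pow5 ?pow4.
- rewrite map_inj_uniq ?enum_uniq // => -[i j] [i' j'].
  rewrite /c /= => /(mulfI (invr_neq0 _)) E.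
  have {}E : w ^+ i * s ^+ 4 + w ^+ j * t ^+ 4
    = w ^+ i' * s ^+ 4 + w ^+ j' * t ^+ 4 by apply: E; rewrite pnatr_eq0.
  have jj : j = j'.
    apply/eqP/negPn/negP => jj.
    have d0 : w ^+ j' - w ^+ j != 0.
      by rewrite subr_eq0; apply: contra jj => /eqP /winj ->.
    case/negP: (te ((i, i'), (j, j'))); rewrite /e /=.
    rewrite -(inj_eq (mulIf d0)) mulfVK // -subr_eq0; apply/eqP.
    transitivity (w ^+ i' * s ^+ 4 + w ^+ j' * t ^+ 4
      - (w ^+ i * s ^+ 4 + w ^+ j * t ^+ 4)); first by ring.
    by rewrite E subrr.
  move: E; rewrite -jj => /addIr /(mulIf (expf_neq0 4 s0)) /winj ->.
  by [].
- by rewrite size_map -cardE card_prod card_ord.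
Qed.

Lemma topcurve_zdeg_eq0 g :
  (forall m, m \in msupp g -> (m o2 < 25)%N) ->
  (forall s t, meval (scurve 0 s t) g = 0) -> g = 0.
Proof.
move=> zg hg; apply: mpoly3_eq0 => x y z.
(* Every [(x, y)] is reached: solve [- s ^ 5 / 5 = x + i y] and [- t ^ 5 / 5 = x - i y]. *)
pose s := 5.-root (- 5 * (x + 'i * y)); pose t := 5.-root (- 5 * (x - 'i * y)).
have s5 : s ^+ 5 = - 5 * (x + 'i * y) by rewrite rootCK.
have t5 : t ^+ 5 = - 5 * (x - 'i * y) by rewrite rootCK.
have -> : meval (pt3 x y z) g = meval (fiber_pt s t z) g.
  apply: meval_eq; apply: I3P;
    rewrite /fiber_pt /scurve /pt3 /= ?scurveA0 ?s5 ?t5 //.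
    by field.
  by field; exact: neq0Ci.
(* Polynomial dependence on [s] extends the vanishing to [s = 0]. *)
have pf : polyfun (fun s => meval (fiber_pt s t z) g).
  apply: polyfun_meval3; last exact: polyfun_cst.
  - by apply: (polyfun_scurve _ _ (@polyfun_id _)); apply: polyfun_cst.
  - by apply: (polyfun_scurve _ _ (@polyfun_id _)); apply: polyfun_cst.
by apply: (polyfun_eq0 pf) => n; apply: meval_fiber_pt_neq0.
Qed.

Lemma curve_zdeg_eq0 g :
  (forall m, m \in msupp g -> (m o2 < 25)%N) ->
  (forall s t, meval (curve s t) g = 0) -> g = 0.
Proof.
move=> zg hg; apply/eqP/negPn/negP => g0.
have ex : exists d, has (fun m => wdeg w554 m == d) (msupp g).
  move: g0; rewrite -msupp_eq0; case: (msupp g) => // m l _.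
  by exists (wdeg w554 m); rewrite /= eqxx.
have bd d : has (fun m => wdeg w554 m == d) (msupp g) ->
    (d <= \max_(m <- msupp g) wdeg w554 m)%N.
  by move=> /hasP [m mg /eqP <-]; apply: leq_bigmax_seq.
(* With [d] the exact weight of [g], the form of weight [d] keeps the nonzero coefficient at [m],
   yet it vanishes on the limit surface. *)
case: (ex_maxnP ex bd) => d /hasP [m mg /eqP E] dmax.
have wg : wbound w554 0 d g.
  by move=> m' mg'; rewrite addn0; apply/dmax/hasP; exists m'.
have h0 : topform d g = 0.
  apply: topcurve_zdeg_eq0; last exact: topform_vanishes.
  move=> m'; rewrite mcoeff_msupp mcoeff_topform mulf_eq0 negb_or => /andP [mg' _].
  by apply: zg; rewrite mcoeff_msupp.
have /eqP := congr1 (mcoeff m) h0.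
rewrite mcoeff_topform mcoeff0 E subnn expr0 mulr1.
by rewrite mcoeff_eq0 mg.
Qed.

End Rigidity.

(** * Euclidean division by a polynomial monic in [z] *)

Section Division.
Variable R : comNzRingType.
Implicit Types f g q r : mpoly 3 R.

(** Makes the degree in [z] a weight, so that the weight bounds apply to it. *)
Definition w001 (i : 'I_3) : nat := (i == o2).

Lemma wdeg_w001 (m : multinom 3) : wdeg w001 m = m o2.
Proof. by rewrite /wdeg big3E /w001 /= mul1n. Qed.

Lemma zmonic_divide f g :
  mcoeff (zmon 25) f = 1 ->
  (forall m, m \in msupp f -> m = zmon 25 \/ (m o2 < 25)%N) ->
  exists q r, g = q * f + r /\ (forall m, m \in msupp r -> (m o2 < 25)%N).
Proof.
move=> f1 ftail.
(* The bound says that the degree in [z] is strictly below [25 + N]; at [N = 0], [g] is its own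
   remainder. *)
have [N gN] : exists N, wbound w001 1 (25 + N) g.
  exists (\max_(m <- msupp g) m o2)%N => m mg.
  rewrite wdeg_w001 addnC leq_add //.
  by rewrite (leq_bigmax_seq (F := fun m : multinom 3 => m o2)).
elim: N g gN => [|N IH] g gN.
  exists 0, g; split; first by rewrite mul0r add0r.
  by move=> m /gN; rewrite wdeg_w001 addn1.
(* The top part of [g] in [z], divided by [z ^ 25]. Subtracting [g1 * f] cancels that part and adds
   only terms of lower degree in [z]. *)
pose g1 : mpoly 3 R := \sum_(m <- msupp g | m o2 == (25 + N)%N)
  mcoeff m g *: mpolyX R (mnm_sub m (zmon 25)).
pose f0 := f - mpolyX R (zmon 25).
have wf0 : wbound w001 1 25 f0.
  apply/wboundP => m; rewrite wdeg_w001 addn1 mcoeffB mcoeffX.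
  case: (eqVneq (zmon 25) m) => [<-|mz]; first by rewrite f1 subrr eqxx.
  rewrite subr0 -mcoeff_msupp => /ftail [E|//].
  by rewrite E eqxx in mz.
have wg1 : wbound w001 0 N g1.
  apply: wbound_sum => m /eqP mN; apply/wboundZ/wboundX.
  by rewrite wdeg_w001 mnmBE mN zmonE /= mul1n addn0 addKn.
have [|q [r [E hr]]] := IH (g - g1 * f); last first.
  exists (q + g1), r; split=> //.
  by rewrite mulrDl addrAC -E subrK.
have -> : g - g1 * f = (g - g1 * mpolyX R (zmon 25)) - g1 * f0.
  by rewrite /f0; ring.
apply: wboundB; last first.
  by apply: wbound_le (wboundM wg1 wf0); lia.
have -> : g1 * mpolyX R (zmon 25)
    = \sum_(m <- msupp g | m o2 == (25 + N)%N) mcoeff m g *: mpolyX R m.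
  rewrite mulr_suml; apply: eq_bigr => m /eqP mN.
  rewrite -scalerAl -mpolyXD submK //; apply/mnm_lepP.
  by apply: I3P; rewrite zmonE //= mN mul1n leq_addr.
set S := (X in g - X).
have -> : g - S = \sum_(m <- msupp g | m o2 != (25 + N)%N) mcoeff m g *: mpolyX R m.
  apply/eqP; rewrite subr_eq addrC {1}[g]mpolyE.
  by rewrite (bigID (fun m : multinom 3 => m o2 == (25 + N)%N)).
rewrite big_seq_cond; apply: wbound_sum => m /andP [mg mN].
apply/wboundZ/wboundX; have := gN _ mg.
by rewrite wdeg_w001; move: mN => /eqP; lia.
Qed.

End Division.

(** * Bour's surface over a field and its complex form *)

Section RealSurface.

Definition bourv (F : fieldType) (u v : F) : 'I_3 -> F :=
  pt3
    (3^-1 * u ^+ 3 - u * v ^+ 2 - 5^-1 * u ^+ 5 + 2 * u ^+ 3 * v ^+ 2 - u * v ^+ 4)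
    (- (u ^+ 2 * v) + 3^-1 * v ^+ 3 - u ^+ 4 * v + 2 * u ^+ 2 * v ^+ 3 - 5^-1 * v ^+ 5)
    (2^-1 * u ^+ 4 - 3 * u ^+ 2 * v ^+ 2 + 2^-1 * v ^+ 4).

Lemma polyfun_bourv (K : numFieldType) (a b : K -> K) i :
  polyfun a -> polyfun b -> polyfun (fun x => bourv (a x) (b x) i).
Proof.
move=> ha hb; move: i; apply: I3P; rewrite /bourv /pt3 /=;
  repeat first [exact: ha | exact: hb | exact: polyfun_cst | apply: polyfunX
    | apply: polyfunM | apply: polyfunN | apply: polyfunD].
Qed.

Lemma bourv_rmorph (F L : fieldType) (phi : {rmorphism F -> L}) u v i :
  bourv (phi u) (phi v) i = phi (bourv u v i).
Proof.
move: i; apply: I3P; rewrite /bourv /pt3 /=;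
by rewrite !(rmorph_nat, fmorphV, rmorphXn, rmorphM, rmorphN, rmorphD).
Qed.

Lemma meval_map_mpoly n (F L : comNzRingType) (phi : {rmorphism F -> L})
    (x : 'I_n -> F) (g : mpoly n F) :
  meval (phi \o x) (map_mpoly phi g) = phi (meval x g).
Proof.
pose ev p := meval (phi \o x) (map_mpoly phi p); rewrite -/(ev g).
have evD : {morph ev : p q / p + q} by move=> p q; rewrite /ev raddfD mevalD.
have ev0 : ev 0 = 0 by rewrite /ev raddf0 meval0.
rewrite {1}[g]mpolyE (big_morph ev evD ev0) mevalE rmorph_sum; apply: eq_bigr => m _ /=.
rewrite /ev map_mpolyZ map_mpolyX mevalZ mevalX rmorphM rmorph_prod /=.
by congr (_ * _); apply: eq_bigr => i _; rewrite rmorphXn.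
Qed.

Lemma curve_bourv (K : numClosedFieldType) (u v : K) i :
  curve (u + 'i * v) (u - 'i * v) i = bourv u v i.
Proof.
have i2 : 'i ^+ 2 = - 1 :> K by rewrite sqrCi.
have i0 := neq0Ci K.
move: i; apply: I3P; rewrite /curve /bourv /pt3 /curveA /=.
- by field: i2.
- by field: i2.
- by field: i2.
Qed.

End RealSurface.

(** * The real implicit equation and its degree *)

Section RealEquation.
Variable R : realType.
Implicit Types (f g h q r : mpoly 3 R).

Local Notation toC := (real_complex R).

Definition bourv_zero g := forall u v : R, meval (bourv u v) g = 0.

Lemma bour4_vanishes_on g : vanishes_on (@bour4 R) g <-> bourv_zero g.
Proof.
have E p : meval (bour4 p 0) g = meval (bourv p.1 p.2) g.
  by apply: meval_eq => i; rewrite /bour4 /vec3 mxE.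
split=> hg; first by move=> u v; rewrite -(E (u, v)) hg.
by move=> p; rewrite E hg.
Qed.

(** The equation holds at positive integer parameters; polynomial dependence extends it to complex
    [u], then to complex [v]. *)
Lemma curve_map_vanishes g : bourv_zero g ->
  forall s t : R[i], meval (curve s t) (map_mpoly toC g) = 0.
Proof.
move=> hg; pose G := map_mpoly toC g.
have h0 (n k : nat) : meval (bourv n.+1%:R k.+1%:R) G = 0 :> R[i].
  rewrite -(rmorph0 toC) -(hg n.+1%:R k.+1%:R) -meval_map_mpoly.
  by apply: meval_eq => i /=; rewrite -bourv_rmorph !rmorph_nat.
have h1 (u : R[i]) (k : nat) : meval (bourv u k.+1%:R) G = 0.
  move: u; apply: polyfun_eq0 => // ; apply: polyfun_meval => i.
  by apply: polyfun_bourv; [exact: polyfun_id|exact: polyfun_cst].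
have h2 (u v : R[i]) : meval (bourv u v) G = 0.
  move: v; apply: polyfun_eq0 => // ; apply: polyfun_meval => i.
  by apply: polyfun_bourv; [exact: polyfun_cst|exact: polyfun_id].
move=> s t; rewrite -/G -(h2 ((s + t) / 2) ((s - t) / (2 * 'i))).
have i0 := neq0Ci R[i].
apply: meval_eq => i; rewrite -curve_bourv.
by congr (curve _ _ i); field.
Qed.

Lemma bourv_zdeg_eq0 g :
  (forall m, m \in msupp g -> (m o2 < 25)%N) -> bourv_zero g -> g = 0.
Proof.
move=> zg hg.
have G0 : map_mpoly toC g = 0.
  apply: curve_zdeg_eq0 (curve_map_vanishes hg) => m.
  rewrite mcoeff_msupp mcoeff_map_mpoly fmorph_eq0 -mcoeff_msupp.
  exact: zg.
apply/mpolyP => m; apply: (fmorph_inj toC).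
by rewrite -mcoeff_map_mpoly G0 !mcoeff0 rmorph0.
Qed.

(** The vanishing ideal is prime: along the line from a parameter where [g] is nonzero to any other,
    both factors are polynomials in one variable with product zero. *)
Lemma bourv_zeroM g h : bourv_zero (g * h) -> bourv_zero g \/ bourv_zero h.
Proof.
move=> gh; have [|ng] := pselect (bourv_zero g); first by left.
right=> u1 v1.
have [u0 [v0 g0]] : exists u0 v0, meval (bourv u0 v0) g <> 0.
  by move/existsNP: ng => [u0 /existsNP [v0 H]]; exists u0, v0.
pose line (c : R) : 'I_3 -> R :=
  bourv (u0 + c * (u1 - u0)) (v0 + c * (v1 - v0)).
have lp f : polyfun (fun c => meval (line c) f).
  apply: polyfun_meval => i; apply: polyfun_bourv;
    (apply: polyfunD; first exact: polyfun_cst);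
    by apply: polyfunM; [apply: polyfun_id|apply: polyfun_cst].
have [c|/(_ 0)|/(_ 1)] := polyfun_mul0 (lp g) (lp h).
- by rewrite -mevalM gh.
- by rewrite /line !mul0r !addr0 => /g0.
- by rewrite /line !mul1r !(addrC _ (_ - _)) !subrK.
Qed.

Lemma complex_ReD (a b : R[i]) : complex.Re (a + b) = complex.Re a + complex.Re b.
Proof. by case: a b => [? ?] [? ?]. Qed.

Lemma complex_ReM (a : R[i]) (b : R) : complex.Re (a * toC b) = complex.Re a * b.
Proof. by case: a => a1 a2 /=; rewrite mulr0 subr0. Qed.

(** Taking real parts of the coefficients preserves vanishing at real points, the weight bound and
    the coefficient 1. *)
Lemma bourv_equation : exists f, [/\ bourv_zero f, wbound w554 0 100 f
  & mcoeff (zmon 25) f = 1].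
Proof.
have [f [fv fw f1]] := curve_equation R[i].
pose g : mpoly 3 R := \sum_(m <- msupp f) complex.Re (mcoeff m f) *: mpolyX R m.
have gE m : mcoeff m g = complex.Re (mcoeff m f).
  rewrite mcoeff_sumX ?msupp_uniq //.
  by case: ifPn => // /memN_msupp_eq0 ->.
exists g; split.
- move=> u v.
  have := fv (toC u + 'i * toC v) (toC u - 'i * toC v).
  rewrite (meval_eq _ (curve_bourv _ _)) => /(congr1 (@complex.Re R)) /= E.
  rewrite -[RHS]E [in RHS]mevalE /g meval_sum.
  rewrite (big_morph _ complex_ReD (erefl : complex.Re (0 : R[i]) = 0)).
  apply: eq_bigr => m _; rewrite mevalZ mevalX -complex_ReM rmorph_prod.
  congr (complex.Re (_ * _)); apply: eq_bigr => i _.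
  by rewrite rmorphXn /= bourv_rmorph.
- apply/wboundP => m; rewrite gE => H; apply: fw.
  by rewrite mcoeff_msupp; apply: contraNneq H => ->.
- by rewrite gE f1.
Qed.

Lemma mpoly_unitP f : f \is a GRing.unit -> exists2 c, c != 0 & f = mpolyC 3 c.
Proof.
move=> /unitrP [y [yf _]].
have /andP [/eqP fE fu] := mpoly_intro_unit yf.
by exists (mcoeff mnm0 f) => //; rewrite -unitfE.
Qed.

Lemma bour4_implicit_equation :
  exists f, implicit_equation (@bour4 R) f /\ mpoly.msize f = 26.
Proof.
have [f [fv fw f1]] := bourv_equation.
have wE (m : multinom 3) : wdeg w554 m = (5 * m o0 + (5 * m o1 + 4 * m o2))%N.
  by rewrite /wdeg big3E.
have dE (m : multinom 3) : mdeg m = (m o0 + (m o1 + m o2))%N.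
  by rewrite mdegE big3E.
have fz : zmon 25 \in msupp f by rewrite mcoeff_msupp f1 oner_eq0.
(* Four times the total degree is at most the weight, hence at most 100; the monomial [z ^ 25]
   attains degree 25. *)
have fsize : mpoly.msize f = 26.
  apply/eqP; rewrite eqn_leq; apply/andP; split.
    rewrite msizeE; apply/bigmax_leqP_seq => m /fw; rewrite wE dE => ? _; lia.
  by have := msize_mdeg_lt fz; rewrite dE !zmonE /=.
have ftail m : m \in msupp f -> m = zmon 25 \/ (m o2 < 25)%N.
  move=> /fw; rewrite wE => wm; have [?|?] := ltnP (m o2) 25; first by right.
  by left; apply/mnmP; apply: I3P; rewrite zmonE /=; lia.
(* The remainder vanishes on the surface and has degree below 25 in [z], so it is zero: [f]
   generates the vanishing ideal. *)
have fdiv g : bourv_zero g -> exists q, g = q * f.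
  move=> gv; have [q [r [E rz]]] := zmonic_divide g f1 ftail.
  exists q; rewrite E (_ : r = 0) ?addr0 //; apply: bourv_zdeg_eq0 => // u v.
  have := gv u v; rewrite E mevalD mevalM fv mulr0 add0r.
  by [].
have f0 : f != 0 by rewrite -msupp_eq0; case: (msupp f) fz.
have fnu : f \isn't a GRing.unit.
  apply/negP => /mpoly_unitP [c c0 fc]; move: fsize.
  by rewrite fc msizeC c0.
have cancel g h q : f = g * h -> g = q * f -> h \is a GRing.unit.
  move=> E1 E2; apply/unitrP; exists q.
  suff qh : q * h = 1 by rewrite [h * q]mulrC.
  by apply: (mulIf f0); rewrite mul1r mulrAC -E2 -E1.
exists f; split=> //; split.
(* By primality [f] divides one of its factors, so the other is a unit. *)
- split=> // g h E.
  have [|/fdiv [q gq]|/fdiv [q hq]] := @bourv_zeroM g h; first by rewrite -E.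
    by right; apply: cancel E gq.
  by left; rewrite mulrC in E; apply: cancel E hq.
- by apply/bour4_vanishes_on.
- move=> g [_ _ girr] /bour4_vanishes_on /fdiv [q gq].
  case: (girr _ _ gq) => [/mpoly_unitP [c c0 qc]|fu]; last by rewrite fu in fnu.
  by exists c => //; rewrite gq qc mul_mpolyC.
Qed.

End RealEquation.

(** * Smoothness and vanishing mean curvature *)

Section Minimality.
Variable R : realType.
Implicit Types (f g df dg : R * R -> R) (w p q : R * R).

(** A class of differentiable functions stable under directional derivatives, so smoothness follows
    by induction on the list of directions. *)
Inductive poly2 : (R * R -> R) -> Prop :=
| poly2_cst c : poly2 (fun=> c)
| poly2_fst : poly2 fst
| poly2_snd : poly2 snd
| poly2D f g : poly2 f -> poly2 g -> poly2 (fun p => f p + g p)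
| poly2M f g : poly2 f -> poly2 g -> poly2 (fun p => f p * g p).

Lemma poly2N f : poly2 f -> poly2 (fun p => - f p).
Proof.
move=> hf; rewrite (_ : (fun p => _) = fun p => -1 * f p).
  by apply: poly2M => //; apply: poly2_cst.
by apply/funext => p; rewrite mulN1r.
Qed.

Lemma poly2X f n : poly2 f -> poly2 (fun p => f p ^+ n).
Proof.
move=> hf; elim: n => [|n IH].
  by rewrite (_ : (fun p => _) = fun=> 1) //; apply: poly2_cst.
rewrite (_ : (fun p => _) = fun p => f p * f p ^+ n); first exact: poly2M.
by apply/funext => p; rewrite exprS.
Qed.

Lemma differentiable_fst p : differentiable (fst : R * R -> R) p.
Proof.
by apply: (linear_differentiable (f := fst)) => q; apply: cvg_fst.
Qed.

Lemma differentiable_snd p : differentiable (snd : R * R -> R) p.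
Proof.
by apply: (linear_differentiable (f := snd)) => q; apply: cvg_snd.
Qed.

Lemma poly2_differentiable f p : poly2 f -> differentiable f p.
Proof.
elim=> {f} [c|||f g _ hf _ hg|f g _ hf _ hg].
- exact: differentiable_cst.
- exact: differentiable_fst.
- exact: differentiable_snd.
- exact: differentiableD.
- exact: differentiableM.
Qed.

Definition pder w f df := forall p, is_derive p w f (df p).

Lemma pder_cst w c : pder w (fun=> c) (fun=> 0).
Proof. by move=> p; apply: is_derive_cst. Qed.

Lemma pder_fst w : pder w fst (fun=> w.1).
Proof.
move=> p; apply: DeriveDef; first exact/diff_derivable/differentiable_fst.
rewrite deriveE; last exact: differentiable_fst.
rewrite (diff_lin (f := fst)) // => q; exact: cvg_fst.
Qed.

Lemma pder_snd w : pder w snd (fun=> w.2).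
Proof.
move=> p; apply: DeriveDef; first exact/diff_derivable/differentiable_snd.
rewrite deriveE; last exact: differentiable_snd.
rewrite (diff_lin (f := snd)) // => q; exact: cvg_snd.
Qed.

Lemma pderD w f df g dg : pder w f df -> pder w g dg ->
  pder w (fun p => f p + g p) (fun p => df p + dg p).
Proof. by move=> hf hg p; apply: is_deriveD. Qed.

Lemma pderN w f df : pder w f df -> pder w (fun p => - f p) (fun p => - df p).
Proof. by move=> hf p; apply: is_deriveN. Qed.

Lemma pderM w f df g dg : pder w f df -> pder w g dg ->
  pder w (fun p => f p * g p) (fun p => f p * dg p + g p * df p).
Proof. by move=> hf hg p; apply: is_deriveM. Qed.

Lemma pderX w f df n : pder w f df ->
  pder w (fun p => f p ^+ n) (fun p => n%:R * f p ^+ n.-1 * df p).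
Proof.
move=> hf p; have := is_deriveX n (hf p).
by rewrite (_ : f ^+ n = (fun p => f p ^+ n)) //; apply/funext => q; rewrite fctE.
Qed.

Lemma pder_eq w f df df' : df =1 df' -> pder w f df -> pder w f df'.
Proof. by move=> E hf p; rewrite -E. Qed.

Lemma poly2_pder w f : poly2 f -> exists2 df, poly2 df & pder w f df.
Proof.
elim=> {f} [c|||f g hf [df pf df'] hg [dg pg dg']|f g hf [df pf df'] hg [dg pg dg']].
- by exists (fun=> 0); [exact: poly2_cst|exact: pder_cst].
- by exists (fun=> w.1); [exact: poly2_cst|exact: pder_fst].
- by exists (fun=> w.2); [exact: poly2_cst|exact: pder_snd].
- by eexists; last exact: (pderD df' dg'); apply: poly2D.
- by eexists; last exact: (pderM df' dg'); apply: poly2D; apply: poly2M.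
Qed.

Lemma derive_coord w (X : R * R -> 'rV[R]_3) (dX : 'I_3 -> R * R -> R) :
  (forall i, pder w (fun p => X p 0 i) (dX i)) ->
  forall p i, 'D_w X p 0 i = dX i p.
Proof.
move=> h p i; rewrite derive_mx ?mxE; first by have [_ ->] := h i p.
by apply/derivable_mxP => j k; rewrite ord1; have [] := h k p.
Qed.

Lemma poly2_smooth (X : R * R -> 'rV[R]_3) :
  (forall i, poly2 (fun p => X p 0 i)) -> smooth_map X.
Proof.
move=> hX s; set Y := foldr _ _ _.
have {}hX : forall i, poly2 (fun p => Y p 0 i).
  rewrite /Y; elim: s {Y} => //= w s IH i; move: IH; set Y := foldr _ _ _ => IH.
  have [dY h] := fin_all_exists2 (fun i => poly2_pder w (IH i)).
  move=> h'; rewrite (_ : (fun p => _) = dY i) //.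
  by apply/funext => p; apply: derive_coord.
move=> p; rewrite (_ : Y = \sum_(i < 3) (fun p => Y p 0 i *: delta_mx 0 i)).
  apply: differentiable_sum => i; apply: differentiableZl.
  exact: poly2_differentiable.
by apply/funext => q; rewrite fct_sumE -row_sum_delta.
Qed.

Lemma derive_vec3 w f g h df dg dh : pder w f df -> pder w g dg -> pder w h dh ->
  (fun p => 'D_w (fun q => vec3 (f q) (g q) (h q)) p)
  = fun p => vec3 (df p) (dg p) (dh p).
Proof.
move=> hf hg hh; apply/funext => p; apply/rowP => i.
have vE (a b c : R * R -> R) j :
    (fun q => vec3 (a q) (b q) (c q) 0 j) = nth (fun=> 0) [:: a; b; c] j.
  by apply/funext; move: j; apply: I3P => q; rewrite /vec3 mxE.
rewrite (derive_coord (dX := fun i p => vec3 (df p) (dg p) (dh p) 0 i)) //.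
by move=> j; rewrite !vE; move: j; apply: I3P.
Qed.

Ltac pder_solve :=
  repeat first [exact: pder_cst | exact: pder_fst | exact: pder_snd
    | apply: pderX | apply: pderN | apply: pderM | apply: pderD].

Lemma bour4_u : partial_u (@bour4 R) = fun p => let u := p.1 in let v := p.2 in
  vec3 (u ^+ 2 - v ^+ 2 - u ^+ 4 + 6 * u ^+ 2 * v ^+ 2 - v ^+ 4)
    (- 2 * u * v - 4 * u ^+ 3 * v + 4 * u * v ^+ 3)
    (2 * u ^+ 3 - 6 * u * v ^+ 2).
Proof.
apply: derive_vec3; (apply: pder_eq; last by pder_solve) => p /=; by field.
Qed.

Lemma bour4_v : partial_v (@bour4 R) = fun p => let u := p.1 in let v := p.2 in
  vec3 (- 2 * u * v + 4 * u ^+ 3 * v - 4 * u * v ^+ 3)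
    (- u ^+ 2 + v ^+ 2 - u ^+ 4 + 6 * u ^+ 2 * v ^+ 2 - v ^+ 4)
    (- 6 * u ^+ 2 * v + 2 * v ^+ 3).
Proof.
apply: derive_vec3; (apply: pder_eq; last by pder_solve) => p /=; by field.
Qed.

Lemma bour4_uu : partial_u (partial_u (@bour4 R)) =
  fun p => let u := p.1 in let v := p.2 in
  vec3 (2 * u - 4 * u ^+ 3 + 12 * u * v ^+ 2)
    (- 2 * v - 12 * u ^+ 2 * v + 4 * v ^+ 3) (6 * u ^+ 2 - 6 * v ^+ 2).
Proof.
rewrite bour4_u.
apply: derive_vec3; (apply: pder_eq; last by pder_solve) => p /=; by ring.
Qed.

(** Each entry is the opposite of the one in [bour4_uu]: the coordinates are harmonic. *)
Lemma bour4_vv : partial_v (partial_v (@bour4 R)) =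
  fun p => let u := p.1 in let v := p.2 in
  vec3 (- (2 * u - 4 * u ^+ 3 + 12 * u * v ^+ 2))
    (- (- 2 * v - 12 * u ^+ 2 * v + 4 * v ^+ 3)) (- (6 * u ^+ 2 - 6 * v ^+ 2)).
Proof.
rewrite bour4_v.
apply: derive_vec3; (apply: pder_eq; last by pder_solve) => p /=; by ring.
Qed.

Lemma dot3_vec3 (a b c a' b' c' : R) :
  dot3 (vec3 a b c) (vec3 a' b' c') = a * a' + (b * b' + c * c').
Proof. by rewrite /dot3 big3E /vec3 !mxE. Qed.

Ltac poly2_solve :=
  repeat first [exact: poly2_cst | exact: poly2_fst | exact: poly2_snd
    | apply: poly2X | apply: poly2N | apply: poly2M | apply: poly2D].

Lemma bour4_minimal : minimal_surface (@bour4 R).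
Proof.
split.
  apply: poly2_smooth; apply: I3P.
  - rewrite (_ : (fun p => _) = fun p => 3^-1 * p.1 ^+ 3 - p.1 * p.2 ^+ 2
        - 5^-1 * p.1 ^+ 5 + 2 * p.1 ^+ 3 * p.2 ^+ 2 - p.1 * p.2 ^+ 4).
      by poly2_solve.
    by apply/funext => p; rewrite /bour4 /vec3 mxE.
  - rewrite (_ : (fun p => _) = fun p => - (p.1 ^+ 2 * p.2) + 3^-1 * p.2 ^+ 3
        - p.1 ^+ 4 * p.2 + 2 * p.1 ^+ 2 * p.2 ^+ 3 - 5^-1 * p.2 ^+ 5).
      by poly2_solve.
    by apply/funext => p; rewrite /bour4 /vec3 mxE.
  - rewrite (_ : (fun p => _) = fun p => 2^-1 * p.1 ^+ 4
        - 3 * p.1 ^+ 2 * p.2 ^+ 2 + 2^-1 * p.2 ^+ 4).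
      by poly2_solve.
    by apply/funext => p; rewrite /bour4 /vec3 mxE.
move=> p _; rewrite /mean_curvature bour4_uu bour4_vv.
set n := unit_normal _ _; rewrite bour4_u bour4_v /=.
(* The numerator vanishes for any vector [n]: [E = G] and [F = 0] by conformality, and [L + N = 0]
   by harmonicity. [M] becomes an arbitrary [m], multiplied by [F]. *)
have -> : n = vec3 (n 0 o0) (n 0 o1) (n 0 o2).
  by apply/rowP; apply: I3P; rewrite /vec3 !mxE.
rewrite !dot3_vec3; move: (p.1) (p.2) (n 0 o0) (n 0 o1) (n 0 o2) => u v a b c.
have F0 (x y : R) : x = 0 -> x / y = 0 by move=> ->; rewrite mul0r.
by apply: F0 => //; move: (dot3 _ _) => m; ring.
Qed.

End Minimality.

Theorem mainTheorem3 (R : realType) :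
  [/\ algebraic_surface (@bour4 R),
      minimal_surface (@bour4 R)
    & surface_degree (@bour4 R) 25].
Proof.
have [f [fE fsize]] := bour4_implicit_equation R.
split; last by exists f; rewrite ?fsize.
  by case: fE => -[f0 _ _] fv _; exists f.
exact: bour4_minimal.
Qed.
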